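(* Let $M$ be a surface of revolution in $\mathbb{I}_p^3$ with nonzero constant Gaussian curvature $K_0$. Then its profile curve is of the form $(u,0,f(u))$, where $$f(u)=\frac{u}{2}\,\psi(u)+\frac{c_1}{2\sqrt{K_0}}\ln\left|2\sqrt{K_0}\left(\sqrt{K_0}\,u+\psi(u)\right)\right|+c_2$$ for $\psi(u)=\sqrt{c_1+K_0u^2}$ and $c_1,c_2\in\mathbb{R}$.
   Context: The pseudo-isotropic space $\mathbb{I}_p^3$ is $\mathbb{R}^3$ with coordinates $(x,y,z)$ and the degenerate metric $ds^2=dx^2-dy^2$. For vectors $a=(a_1,a_2,a_3)$, $b=(b_1,b_2,b_3)$, the scalar product is $\langle a,b\rangle=a_3b_3$ if $a_1=a_2=b_1=b_2=0$, and $\langle a,b\rangle=a_1b_1-a_2b_2$ otherwise. A surface of revolution in $\mathbb{I}_p^3$ is a surface given, for a smooth function $f$, by one of the following: $r(u,v)=(u\cosh v,\,u\sinh v,\,f(u))$, obtained by rotating the spacelike curve $u\mapsto(u,0,f(u))$ of the $xz$-plane about the $z$-axis by the hyperbolic rotations $\bar x=x\cosh\theta+y\sinh\theta$, $\bar y=x\sinh\theta+y\cosh\theta$, $\theta\in\mathbb{R}$; or $r(u,v)=(u\sinh v,\,u\cosh v,\,f(u))$, obtained in the same way from the timelike curve $u\mapsto(0,u,f(u))$ of the $yz$-plane. The rotated curve is called the profile curve. Surfaces are assumed to be immersed, without tangent planes parallel to the $z$-axis, and timelike (the induced metric is non-degenerate of index 1). For a parameterized surface $r(u_1,u_2)$,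 put $g_{ij}=\langle r_{u_i},r_{u_j}\rangle$ and $h_{ij}=\det(r_{u_1},r_{u_2},r_{u_iu_j})/\sqrt{|\det(g_{ij})|}$, where subscripts $u_i$ denote partial derivatives and $\det$ of three vectors is the usual determinant in $\mathbb{R}^3$. The Gaussian curvature is $K=\det(h_{ij})/\det(g_{ij})$.
   Formalization: ψ may be either square root ±√(c1+K0u²), since −f has the same curvature; a profile in the yz-plane has the form (0,u,f(u)) with the same f; for K0<0, where √K0 is not real, the logarithmic term becomes c1/(2√(−K0))·arctan(√(−K0)u/ψ(u)). *)

(* Defs.v *)
From Stdlib Require Import Reals Lra.
From Coquelicot Require Import Coquelicot.
Open Scope R_scope.

Definition vec : Type := (R * R * R)%type.
Definition cx (a : vec) : R := fst (fst a).
Definition cy (a : vec) : R := snd (fst a).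
Definition cz (a : vec) : R := snd a.

Definition lincomb (s : R) (a : vec) (t : R) (b : vec) : vec :=
  (s * cx a + t * cx b, s * cy a + t * cy b, s * cz a + t * cz b).

Definition pdot (a b : vec) : R :=
  if Req_EM_T (cx a) 0 then
    if Req_EM_T (cy a) 0 then
      if Req_EM_T (cx b) 0 then
        if Req_EM_T (cy b) 0 then cz a * cz b
        else cx a * cx b - cy a * cy b
      else cx a * cx b - cy a * cy b
    else cx a * cx b - cy a * cy b
  else cx a * cx b - cy a * cy b.

Definition det3 (a b c : vec) : R :=
  cx a * (cy b * cz c - cz b * cy c)
  - cy a * (cx b * cz c - cz b * cx c)
  + cz a * (cx b * cy c - cy b * cx c).

Definition surface : Type := R -> R -> vec.

Inductive coord : Set := U1 | U2.

Definition pd (i : coord) (r : surface) : surface := fun u v =>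
  match i with
  | U1 => (Derive (fun t => cx (r t v)) u,
           Derive (fun t => cy (r t v)) u,
           Derive (fun t => cz (r t v)) u)
  | U2 => (Derive (fun t => cx (r u t)) v,
           Derive (fun t => cy (r u t)) v,
           Derive (fun t => cz (r u t)) v)
  end.

Definition det2 (m : coord -> coord -> R) : R :=
  m U1 U1 * m U2 U2 - m U1 U2 * m U2 U1.

Definition fund1 (r : surface) (u v : R) (i j : coord) : R :=
  pdot (pd i r u v) (pd j r u v).

(* [pd j (pd i r)] differentiates first in [u_i], then in [u_j]. *)
Definition fund2 (r : surface) (u v : R) (i j : coord) : R :=
  det3 (pd U1 r u v) (pd U2 r u v) (pd j (pd i r) u v)
  / sqrt (Rabs (det2 (fund1 r u v))).

Definition gauss_curvature (r : surface) (u v : R) : R :=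
  det2 (fund2 r u v) / det2 (fund1 r u v).

Definition immersed_at (r : surface) (u v : R) : Prop :=
  forall s t, lincomb s (pd U1 r u v) t (pd U2 r u v) = (0, 0, 0) ->
    s = 0 /\ t = 0.

Definition tangent_parallel_to_z (r : surface) (u v : R) : Prop :=
  exists s t, lincomb s (pd U1 r u v) t (pd U2 r u v) = (0, 0, 1).

Definition quad (m : coord -> coord -> R) (s t : R) : R :=
  m U1 U1 * s * s + m U1 U2 * s * t + m U2 U1 * t * s + m U2 U2 * t * t.

(* The index is the largest dimension of a negative definite subspace: it is 1
   when some line is negative definite but the whole plane is not. *)
Definition index_one (m : coord -> coord -> R) : Prop :=
  (exists s t, quad m s t < 0) /\
  ~ (forall s t, (s, t) <> (0, 0) -> quad m s t < 0).

Definition timelike_at (r : surface) (u v : R) : Prop :=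
  det2 (fund1 r u v) <> 0 /\ index_one (fund1 r u v).

Definition admissible_timelike (I : R -> Prop) (r : surface) : Prop :=
  forall u v, I u ->
    immersed_at r u v /\ ~ tangent_parallel_to_z r u v /\ timelike_at r u v.

Definition is_open_interval (I : R -> Prop) : Prop :=
  open I /\ forall a b c, I a -> I c -> a <= b <= c -> I b.

Definition smooth_on (I : R -> Prop) (f : R -> R) : Prop :=
  forall n u, I u -> ex_derive_n f n u.

Inductive profile_kind : Set := Spacelike | Timelike.

Definition profile_curve (k : profile_kind) (f : R -> R) (u : R) : vec :=
  match k with
  | Spacelike => (u, 0, f u)
  | Timelike => (0, u, f u)
  end.

Definition hrot (theta : R) (a : vec) : vec :=
  (cx a * cosh theta + cy a * sinh theta,
   cx a * sinh theta + cy a * cosh theta,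
   cz a).

Definition revolution (k : profile_kind) (f : R -> R) : surface := fun u v =>
  match k with
  | Spacelike => (u * cosh v, u * sinh v, f u)
  | Timelike => (u * sinh v, u * cosh v, f u)
  end.

Lemma revolution_hrot (k : profile_kind) (f : R -> R) (u v : R) :
  revolution k f u v = hrot v (profile_curve k f u).
Proof.
  destruct k; unfold revolution, hrot, profile_curve, cx, cy, cz; simpl;
    (apply (f_equal2 pair); [apply (f_equal2 pair); ring | reflexivity]).
Qed.

(* [psi] is one of the two continuous square roots of [c1 + K0 u^2] on [I].
   Both occur: [f] and [- f] give surfaces with the same Gaussian curvature.
   The radicand is required positive because [sqrt] is 0 on negative reals. *)
Definition root_branch (I : R -> Prop) (K0 c1 : R) (psi : R -> R) : Prop :=
  (forall u, I u -> 0 < c1 + K0 * u ^ 2) /\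
  ((forall u, psi u = sqrt (c1 + K0 * u ^ 2)) \/
   (forall u, psi u = - sqrt (c1 + K0 * u ^ 2))).

Definition height_pos (K0 c1 c2 : R) (psi : R -> R) (u : R) : R :=
  u / 2 * psi u
  + c1 / (2 * sqrt K0) * ln (Rabs (2 * sqrt K0 * (sqrt K0 * u + psi u)))
  + c2.

(* For [K0 < 0], [sqrt K0] is imaginary, [sqrt K0 = i k] with
   [k = sqrt (- K0)], and the logarithm of [i k u + psi u] contributes,
   up to an additive constant, [c1 / (2 k)] times the argument
   [atan (k u / psi u)]. *)
Definition height_neg (K0 c1 c2 : R) (psi : R -> R) (u : R) : R :=
  u / 2 * psi u
  + c1 / (2 * sqrt (- K0)) * atan (sqrt (- K0) * u / psi u)
  + c2.

(* Main.v *)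
(** Both kinds of surfaces of revolution have curvature [K = f' f'' / u], so
    constancy of [K] reads [(f'^2)' = (K0 u^2)']: the function
    [f'^2 - K0 u^2] is a constant [c1].  As [K0 <> 0], [f'] never vanishes, so it
    is one branch [psi] of the square root of [c1 + K0 u^2] on the whole
    interval, and [f] is a primitive of that branch. *)

Require Import Defs.
From Stdlib Require Import Reals Ranalysis5 Lra Classical.
From Coquelicot Require Import Coquelicot.
Open Scope R_scope.

(** * Calculus on an interval *)

Lemma is_derive_cosh (v : R) : is_derive cosh v (sinh v).
Proof. apply is_derive_Reals, derivable_pt_lim_cosh. Qed.

Lemma is_derive_sinh (v : R) : is_derive sinh v (cosh v).
Proof. apply is_derive_Reals, derivable_pt_lim_sinh. Qed.

Lemma cosh_sinh_sqr (v : R) : cosh v * cosh v - sinh v * sinh v = 1.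
Proof.
  assert (E : exp v * exp (- v) = 1)
    by (rewrite <- exp_plus, Rplus_opp_r; apply exp_0).
  unfold cosh, sinh; lra.
Qed.

Lemma is_derive_zero_const (I : R -> Prop) (g : R -> R) (x y : R) :
  is_open_interval I -> (forall u, I u -> is_derive g u 0) ->
  I x -> I y -> g x = g y.
Proof.
  intros [_ conv] dg Ix Iy.
  destruct (Rtotal_order x y) as [xy | [-> | yx]]; [| reflexivity | symmetry];
    apply (eq_is_derive g); trivial; intros t Ht; apply dg;
    eauto using conv.
Qed.

(** Serves twice: comparing [f'^2] with [K0 u^2] produces [c1], and comparing [f] with the explicit
    height produces [c2]. *)
Lemma primitives_differ_by_const (I : R -> Prop) (g h d : R -> R) :
  is_open_interval I ->
  (forall u, I u -> is_derive g u (d u)) ->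
  (forall u, I u -> is_derive h u (d u)) ->
  exists c, forall u, I u -> g u = h u + c.
Proof.
  intros HI dg dh.
  destruct (classic (exists u, I u)) as [[x Ix] | none].
  - exists (g x - h x); intros u Iu.
    assert (E : g u - h u = g x - h x); [| lra].
    apply (is_derive_zero_const I (fun t => g t - h t)); trivial.
    intros t It; replace 0 with (minus (d t) (d t)) by apply Rminus_diag.
    apply (is_derive_minus g h); auto.
  (* [is_open_interval] admits the empty set, where any constant serves. *)
  - exists 0; intros u Iu; destruct none; eauto.
Qed.

(** A change of sign would force a zero by the intermediate value theorem. *)
Lemma continuous_nonzero_sign (I : R -> Prop) (g : R -> R) :
  is_open_interval I -> (forall u, I u -> continuous g u) ->
  (forall u, I u -> g u <> 0) ->
  (forall u, I u -> 0 < g u) \/ (forall u, I u -> g u < 0).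
Proof.
  intros [_ conv] cg nz.
  assert (same : forall x y, I x -> I y -> g x < 0 -> ~ 0 < g y).
  { intros x y Ix Iy gx gy.
    destruct (Rtotal_order x y) as [xy | [-> | yx]]; [| lra |].
    - destruct (IVT_interv g x y) as [z [Hz gz]]; trivial.
      + intros a Ha; apply continuity_pt_filterlim, cg; eauto using conv.
      + apply (nz z); eauto using conv.
    (* [IVT_interv] asks for a negative value at the left end; here the positive value lies there,
       so [g] is negated. *)
    - destruct (IVT_interv (fun t => - g t) y x) as [z [Hz gz]]; try lra.
      + intros a Ha; apply continuity_pt_opp, continuity_pt_filterlim, cg.
        eauto using conv.
      + apply (nz z); [eauto using conv | lra]. }
  destruct (classic (exists x, I x /\ g x < 0)) as [[x [Ix gx]] | none].
  - right; intros u Iu; specialize (same x u Ix Iu gx).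
    specialize (nz u Iu); lra.
  - left; intros u Iu; specialize (nz u Iu).
    destruct (Rlt_dec 0 (g u)); trivial.
    destruct none; exists u; split; trivial; lra.
Qed.

(** * Curvature of surfaces of revolution *)

(** With [X = rotation_x k] and [Y = rotation_y k], both kinds of surface read [(u X, u Y, f u)],
    where [X' = Y], [Y' = X] and [X^2 - Y^2] is a sign; one computation then covers both. *)
Definition rotation_x (k : profile_kind) : R -> R :=
  match k with Spacelike => cosh | Timelike => sinh end.

Definition rotation_y (k : profile_kind) : R -> R :=
  match k with Spacelike => sinh | Timelike => cosh end.

(** This sign [e] is the coefficient [g_11] of the induced metric. *)
Definition causal_sign (k : profile_kind) : R :=
  match k with Spacelike => 1 | Timelike => -1 end.

Lemma Derive_rotation_x (k : profile_kind) (v : R) :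
  Derive (rotation_x k) v = rotation_y k v.
Proof.
  apply is_derive_unique; destruct k;
    [apply is_derive_cosh | apply is_derive_sinh].
Qed.

Lemma Derive_rotation_y (k : profile_kind) (v : R) :
  Derive (rotation_y k) v = rotation_x k v.
Proof.
  apply is_derive_unique; destruct k;
    [apply is_derive_sinh | apply is_derive_cosh].
Qed.

Lemma rotation_sqr (k : profile_kind) (v : R) :
  rotation_x k v * rotation_x k v - rotation_y k v * rotation_y k v
  = causal_sign k.
Proof.
  generalize (cosh_sinh_sqr v); destruct k; simpl; lra.
Qed.

Lemma revolution_rotation (k : profile_kind) (f : R -> R) (u v : R) :
  revolution k f u v = (u * rotation_x k v, u * rotation_y k v, f u).
Proof. destruct k; reflexivity. Qed.

Lemma Derive_scal_var (a u : R) : Derive (fun t => t * a) u = a.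
Proof. apply is_derive_unique; auto_derive; trivial; ring. Qed.

Lemma pd1_revolution (k : profile_kind) (f : R -> R) (u v : R) :
  pd U1 (revolution k f) u v = (rotation_x k v, rotation_y k v, Derive f u).
Proof.
  destruct k; cbn; rewrite !Derive_scal_var; reflexivity.
Qed.

Lemma pd2_revolution (k : profile_kind) (f : R -> R) (u v : R) :
  pd U2 (revolution k f) u v = (u * rotation_y k v, u * rotation_x k v, 0).
Proof.
  (* Once the target is expressed through [Derive], pulling the factor [u] out on the left makes
     both sides agree. *)
  rewrite <- Derive_rotation_x, <- Derive_rotation_y.
  destruct k; cbn; rewrite !Derive_scal, Derive_const; reflexivity.
Qed.

(** Allows the closed forms of the first partial derivatives, which hold at every point, to be
    substituted under an outer [pd]. *)
Lemma pd_ext (i : coord) (r s : surface) (u v : R) :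
  (forall a b, r a b = s a b) -> pd i r u v = pd i s u v.
Proof.
  intros E; destruct i; simpl; repeat apply (f_equal2 pair);
    apply Derive_ext; intros t; rewrite E; reflexivity.
Qed.

Lemma pd11_revolution (k : profile_kind) (f : R -> R) (u v : R) :
  pd U1 (pd U1 (revolution k f)) u v = (0, 0, Derive_n f 2 u).
Proof.
  rewrite (pd_ext _ _ _ _ _ (pd1_revolution k f)); cbn.
  rewrite !Derive_const; reflexivity.
Qed.

Lemma pd12_revolution (k : profile_kind) (f : R -> R) (u v : R) :
  pd U2 (pd U1 (revolution k f)) u v = (rotation_y k v, rotation_x k v, 0).
Proof.
  rewrite (pd_ext _ _ _ _ _ (pd1_revolution k f)).
  rewrite <- Derive_rotation_x, <- Derive_rotation_y; cbn.
  rewrite Derive_const; reflexivity.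
Qed.

Lemma pd21_revolution (k : profile_kind) (f : R -> R) (u v : R) :
  pd U1 (pd U2 (revolution k f)) u v = (rotation_y k v, rotation_x k v, 0).
Proof.
  rewrite (pd_ext _ _ _ _ _ (pd2_revolution k f)); cbn.
  rewrite !Derive_scal_var, Derive_const; reflexivity.
Qed.

Lemma pd22_revolution (k : profile_kind) (f : R -> R) (u v : R) :
  pd U2 (pd U2 (revolution k f)) u v
  = (u * rotation_x k v, u * rotation_y k v, 0).
Proof.
  rewrite (pd_ext _ _ _ _ _ (pd2_revolution k f)).
  rewrite <- Derive_rotation_x, <- Derive_rotation_y; cbn.
  rewrite !Derive_scal, Derive_const, Derive_rotation_x, Derive_rotation_y.
  reflexivity.
Qed.

(** The hypothesis keeps the first two coordinates of [a] from both vanishing, which rules out the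
    branch [cz a * cz b]. *)
Lemma pdot_nonisotropic (a b : vec) :
  cx a * cx a - cy a * cy a <> 0 ->
  pdot a b = cx a * cx b - cy a * cy b.
Proof.
  unfold pdot; intros na.
  destruct (Req_EM_T (cx a) 0) as [x0 |]; trivial.
  destruct (Req_EM_T (cy a) 0) as [y0 |]; trivial.
  destruct na; rewrite x0, y0; ring.
Qed.

(** Here [g_11 = e], [g_12 = 0] and [g_22 = - e u^2] with [e = causal_sign k], and [e^2 = 1]. *)
Lemma det2_fund1_revolution (k : profile_kind) (f : R -> R) (u v : R) :
  u <> 0 -> det2 (fund1 (revolution k f) u v) = - (u * u).
Proof.
  intros u0; unfold det2, fund1.
  generalize (rotation_sqr k v); intros E.
  assert (nz : causal_sign k <> 0) by (destruct k; simpl; lra).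
  assert (E1 : causal_sign k * causal_sign k = 1) by (destruct k; simpl; ring).
  rewrite pd1_revolution, pd2_revolution.
  set (a := rotation_x k v) in *; set (b := rotation_y k v) in *.
  assert (nu : a * a - b * b <> 0) by (rewrite E; exact nz).
  assert (nv : u * b * (u * b) - u * a * (u * a) <> 0).
  { replace (_ - _) with (- (u * u * (a * a - b * b))) by ring.
    rewrite E; apply Ropp_neq_0_compat.
    repeat apply Rmult_integral_contrapositive_currified; trivial. }
  rewrite !pdot_nonisotropic; unfold cx, cy; simpl; trivial.
  transitivity (- (u * u) * ((a * a - b * b) * (a * a - b * b))); [ring |].
  rewrite E, E1; ring.
Qed.

(** The determinants in [h_11], [h_12], [h_22] are [e u f''], [0] and [- e u^2 f'], so the sign [e]
    enters [K] only squared. *)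
Lemma gauss_curvature_revolution (k : profile_kind) (f : R -> R) (u v : R) :
  u <> 0 ->
  gauss_curvature (revolution k f) u v = Derive f u * Derive_n f 2 u / u.
Proof.
  intros u0; unfold gauss_curvature.
  unfold det2 at 1, fund2.
  rewrite det2_fund1_revolution by trivial.
  rewrite pd11_revolution, pd12_revolution, pd21_revolution, pd22_revolution,
    pd1_revolution, pd2_revolution.
  rewrite Rabs_Ropp, Rabs_pos_eq by apply Rle_0_sqr.
  assert (s0 : sqrt (u * u) <> 0).
  { apply Rgt_not_eq, sqrt_lt_R0; generalize (Rsqr_pos_lt u u0); trivial. }
  assert (s2 : sqrt (u * u) * sqrt (u * u) = u * u)
    by apply sqrt_sqrt, Rle_0_sqr.
  assert (E : (rotation_x k v * rotation_x k v - rotation_y k v * rotation_y k v)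
              * (rotation_x k v * rotation_x k v - rotation_y k v * rotation_y k v)
              = 1)
    by (rewrite rotation_sqr; destruct k; simpl; ring).
  set (a := rotation_x k v) in *; set (b := rotation_y k v) in *.
  set (p := Derive f u); set (q := Derive_n f 2 u).
  (* [s] is the absolute value of [u]; only [s * s] survives in the curvature, so the sign of [u]
     need not be split. *)
  set (s := sqrt (u * u)) in *.
  unfold det3, cx, cy, cz; simpl.
  transitivity (- (u * u * u * p * q * ((a * a - b * b) * (a * a - b * b)))
                / (s * s) / (- (u * u))).
  - field; auto.
  - rewrite E, s2; field; auto.
Qed.

(** On the axis [r_v] vanishes, so the coefficients [(0, 1)] give a nontrivial relation. *)
Lemma immersed_revolution_neq0 (k : profile_kind) (f : R -> R) (u v : R) :
  immersed_at (revolution k f) u v -> u <> 0.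
Proof.
  intros imm u0.
  destruct (imm 0 1) as [_ H]; [| lra].
  rewrite pd2_revolution; unfold lincomb, cx, cy, cz; simpl; rewrite u0.
  repeat apply (f_equal2 pair); ring.
Qed.

(** * The profile equation *)

(** Differentiating [psi^2 = c1 + K0 u^2] gives [psi psi' = K0 u], whichever sign the root has. *)
Lemma is_derive_root_branch (I : R -> Prop) (K0 c1 : R) (psi : R -> R) (u : R) :
  root_branch I K0 c1 psi -> I u ->
  is_derive psi u (K0 * u / psi u) /\ psi u <> 0 /\
  psi u * psi u = c1 + K0 * u ^ 2.
Proof.
  intros [pos br] Iu; specialize (pos u Iu).
  assert (s0 := sqrt_lt_R0 _ pos).
  assert (s2 := sqrt_sqrt _ (Rlt_le _ _ pos)).
  destruct br as [E | E]; rewrite E;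
    (split; [| split; [lra | rewrite ?Rmult_opp_opp; exact s2]]);
    (eapply is_derive_ext; [intros t; symmetry; apply E |]);
    (auto_derive; [exact pos | simpl in *; field; lra]).
Qed.

(** The product contributes [psi / 2 + K0 u^2 / (2 psi)] and the logarithmic term [c1 / (2 psi)]; by
    [psi^2 = c1 + K0 u^2] they add up to [psi]. *)
Lemma is_derive_height_pos (I : R -> Prop) (K0 c1 c2 : R) (psi : R -> R) (u : R) :
  0 < K0 -> root_branch I K0 c1 psi -> I u ->
  is_derive (height_pos K0 c1 c2 psi) u (psi u).
Proof.
  intros HK B Iu.
  destruct (is_derive_root_branch _ _ _ _ u B Iu) as [d [nz sq]].
  assert (D : Derive (fun t => psi t) u = K0 * u / psi u)
    by exact (is_derive_unique _ _ _ d).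
  assert (k0 := sqrt_lt_R0 _ HK).
  assert (k2 := sqrt_sqrt _ (Rlt_le _ _ HK)).
  unfold height_pos; set (k := sqrt K0) in *.
  (* For [c1 = 0] the argument of [ln] may vanish identically. *)
  destruct (Req_dec c1 0) as [c0 | c0].
  - assert (E : forall t : R, t / 2 * psi t + c2 =
        t / 2 * psi t + c1 / (2 * k) * ln (Rabs (2 * k * (k * t + psi t))) + c2)
      by (intros t; rewrite c0; unfold Rdiv; ring).
    apply (is_derive_ext _ _ _ _ E).
    auto_derive; [exists (K0 * u / psi u); exact d |].
    rewrite D; field_simplify_eq; trivial; nra.
  (* The product [(psi + k u) (psi - k u)] equals [c1], so neither factor vanishes. *)
  - assert (nz2 : k * u + psi u <> 0).
    { intros E; apply c0.
      replace c1 with ((psi u + k * u) * (psi u - k * u)); [nra |].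
      replace ((psi u + k * u) * (psi u - k * u))
        with (psi u * psi u - k * k * u ^ 2) by ring.
      rewrite sq, k2; ring. }
    assert (nz3 : 2 * k * (k * u + psi u) <> 0)
      by (apply Rmult_integral_contrapositive_currified; trivial; lra).
    set (ell := fun t => ln (Rabs (2 * k * (k * t + psi t)))).
    assert (d2 : is_derive ell u (k / psi u)).
    { assert (dl : is_derive (fun y => ln (Rabs y)) (2 * k * (k * u + psi u))
                     (/ (2 * k * (k * u + psi u)))).
      { destruct (Rlt_dec 0 (2 * k * (k * u + psi u))) as [p | n];
          (auto_derive; [split; [| split; trivial]; trivial; apply Rabs_pos_lt; trivial |]).
        - rewrite sign_eq_1, Rabs_pos_eq by lra; field; split; trivial; lra.
        - rewrite sign_eq_m1, Rabs_left by lra; field; split; trivial; lra. }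
      assert (di : is_derive (fun t => 2 * k * (k * t + psi t)) u
                     (2 * k * (k + K0 * u / psi u))).
      { auto_derive; [exists (K0 * u / psi u); exact d |].
        rewrite D; field; trivial. }
      (* The inner derivative is [2 k] times [k (k u + psi) / psi], so the argument of the logarithm
         cancels. *)
      replace (k / psi u) with
        (scal (2 * k * (k + K0 * u / psi u)) (/ (2 * k * (k * u + psi u)))).
      - exact (is_derive_comp _ _ _ _ _ dl di).
      - cbn; unfold mult; cbn; rewrite <- k2; field; repeat split; trivial; lra. }
    change (is_derive (fun t => t / 2 * psi t + c1 / (2 * k) * ell t + c2)
              u (psi u)).
    auto_derive.
    + repeat split; trivial; eexists; [exact d | exact d2].
    + assert (D2 : Derive (fun t => ell t) u = k / psi u)
        by exact (is_derive_unique _ _ _ d2).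
      rewrite D, D2; field_simplify_eq; [nra | split; trivial; lra].
Qed.

(** With [k^2 = - K0], the quotient [k u / psi] has derivative [k c1 / psi^3], and
    [1 + (k u / psi)^2 = c1 / psi^2]; hence the arctangent has derivative [k / psi], as the
    logarithm does for [K0 > 0]. *)
Lemma is_derive_height_neg (I : R -> Prop) (K0 c1 c2 : R) (psi : R -> R) (u : R) :
  K0 < 0 -> root_branch I K0 c1 psi -> I u ->
  is_derive (height_neg K0 c1 c2 psi) u (psi u).
Proof.
  intros HK B Iu.
  destruct (is_derive_root_branch _ _ _ _ u B Iu) as [d [nz sq]].
  assert (D : Derive (fun t => psi t) u = K0 * u / psi u)
    by exact (is_derive_unique _ _ _ d).
  assert (k0 : 0 < sqrt (- K0)) by (apply sqrt_lt_R0; lra).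
  assert (k2 : sqrt (- K0) * sqrt (- K0) = - K0) by (apply sqrt_sqrt; lra).
  unfold height_neg; set (k := sqrt (- K0)) in *.
  (* Eliminating [c1] in favour of [psi] and [k] lets [field] cancel the denominator produced by
     [atan]. *)
  assert (c1E : c1 = psi u * psi u + k * k * (u * u)) by (rewrite k2, sq; ring).
  assert (KE : K0 = - (k * k)) by lra.
  assert (c0 : psi u * psi u + k * k * (u * u) <> 0).
  { generalize (Rsqr_pos_lt _ nz) (Rle_0_sqr (k * u)); unfold Rsqr; nra. }
  auto_derive.
  - repeat split; trivial; exists (K0 * u / psi u); exact d.
  - rewrite D, c1E, KE.
    field; repeat split; trivial; try lra.
Qed.

Lemma profile_slope_sqr (I : R -> Prop) (k : profile_kind) (f : R -> R) (K0 : R) :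
  is_open_interval I -> smooth_on I f ->
  admissible_timelike I (revolution k f) ->
  (forall u v, I u -> gauss_curvature (revolution k f) u v = K0) ->
  exists c1, forall u, I u -> Derive f u * Derive f u = K0 * u ^ 2 + c1.
Proof.
  intros HI Hf HM HK.
  apply (primitives_differ_by_const I (fun t => Derive f t * Derive f t)
           (fun t => K0 * t ^ 2) (fun t => 2 * K0 * t)); trivial;
    intros u Iu.
  - assert (u0 : u <> 0)
      by (apply (immersed_revolution_neq0 k f u 0), HM; trivial).
    assert (E := HK u 0 Iu); rewrite gauss_curvature_revolution in E by trivial.
    assert (d2 : ex_derive (Derive f) u) by exact (Hf 2%nat u Iu).
    auto_derive; [repeat split; trivial |].
    change (Derive (fun t => Derive f t) u) with (Derive_n f 2 u).
    rewrite <- E; field; trivial.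
  - auto_derive; trivial; ring.
Qed.

(** The curvature formula is the same for both kinds, so the same heights arise in either coordinate
    plane; hence the conclusion through [profile_curve k]. *)
Theorem theorem5p1 (I : R -> Prop) (k : profile_kind) (f : R -> R) (K0 : R)
    (hI : is_open_interval I) (hf : smooth_on I f)
    (hM : admissible_timelike I (revolution k f))
    (hK0 : K0 <> 0)
    (hK : forall u v, I u -> gauss_curvature (revolution k f) u v = K0) :
  exists (c1 c2 : R) (psi : R -> R),
    root_branch I K0 c1 psi /\
    (0 < K0 -> forall u, I u ->
       profile_curve k f u = profile_curve k (height_pos K0 c1 c2 psi) u) /\
    (K0 < 0 -> forall u, I u ->
       profile_curve k f u = profile_curve k (height_neg K0 c1 c2 psi) u).
Proof.
  destruct (profile_slope_sqr I k f K0 hI hf hM hK) as [c1 slope].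
  assert (nz : forall u, I u -> Derive f u <> 0).
  { intros u Iu D0; apply hK0.
    rewrite <- (hK u 0 Iu), gauss_curvature_revolution, D0.
    - unfold Rdiv; ring.
    - apply (immersed_revolution_neq0 k f u 0), hM; trivial. }
  assert (pos : forall u, I u -> 0 < c1 + K0 * u ^ 2).
  { intros u Iu; rewrite Rplus_comm, <- slope by trivial.
    exact (Rsqr_pos_lt _ (nz u Iu)). }
  assert (br : exists psi, root_branch I K0 c1 psi /\
                 forall u, I u -> Derive f u = psi u).
  (* The constant sign of [f'] on [I] selects one root for the whole interval. *)
  { destruct (continuous_nonzero_sign I (Derive f)) as [sg | sg]; trivial.
    - intros u Iu; apply (ex_derive_continuous (Derive f)).
      exact (hf 2%nat u Iu).
    - exists (fun u => sqrt (c1 + K0 * u ^ 2)); split; [split; auto |].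
      intros u Iu; rewrite Rplus_comm, <- slope, sqrt_square; auto using Rlt_le.
    - exists (fun u => - sqrt (c1 + K0 * u ^ 2)); split; [split; auto |].
      intros u Iu; specialize (sg u Iu).
      rewrite Rplus_comm, <- slope by trivial.
      rewrite <- (Rmult_opp_opp (Derive f u)), sqrt_square; lra. }
  destruct br as [psi [B E]].
  assert (df : forall u, I u -> is_derive f u (psi u)).
  { intros u Iu; rewrite <- E by trivial.
    apply Derive_correct, (hf 1%nat u Iu). }
  assert (conclude : forall g : R -> R, (forall u, I u -> f u = g u) ->
            forall u, I u -> profile_curve k f u = profile_curve k g u).
  { intros g Eg u Iu; destruct k; simpl; rewrite (Eg u Iu); reflexivity. }
  destruct (Rlt_dec 0 K0) as [Kp | Kn].
  (* The height with additive constant [0] is one primitive of [psi]; its difference from [f] is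
     [c2]. *)
  - destruct (primitives_differ_by_const I f (height_pos K0 c1 0 psi) psi)
      as [c2 Hc]; trivial.
    { intros u Iu; apply (is_derive_height_pos I); trivial. }
    exists c1, c2, psi; split; [exact B | split; [intros _ | lra]].
    apply conclude; intros u Iu; rewrite Hc by trivial; unfold height_pos; ring.
  - assert (Km : K0 < 0) by lra.
    destruct (primitives_differ_by_const I f (height_neg K0 c1 0 psi) psi)
      as [c2 Hc]; trivial.
    { intros u Iu; apply (is_derive_height_neg I); trivial. }
    exists c1, c2, psi; split; [exact B | split; [lra | intros _]].
    apply conclude; intros u Iu; rewrite Hc by trivial; unfold height_neg; ring.
Qed.
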